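(* Let $g_A$ be a grading on $Q_{A'}$ such that $\omega_{A'}$ is homogeneous of degree $a$ and the morphism $\Phi'\colon Q_{A'}\to\tilde Q_{G'}$ is $g_A$-gradable. Then there exists a grading $g_G$ on $Q_{G'}$ such that $\omega_{G'}$ is homogeneous of degree $a$.
   Context: Gradings. A grading on a quiver $Q$ is a map $g$ from its set of arrows to $\mathbb Z$; it induces a grading of the path algebra (vertices in degree $0$, degree of a path = sum of degrees of its arrows). A morphism of quivers $\phi\colon Q\to Q'$ is $g$-gradable if for every arrow $b$ of $Q'$ all arrows in $\phi^{-1}(b)$ have the same $g$-degree (or $\phi^{-1}(b)=\varnothing$). Group. Let $m,r,s,t$ be positive integers with $\gcd(m,r)=1$; $r^s\equiv 1\pmod m$; $(r-1)t\equiv 0\pmod m$; $s$ prime; $r\not\equiv 1\pmod m$. Write $\epsilon_k$ for a fixed primitive $k$-th root of unity. $G\le\mathrm{GL}(s,\mathbb C)$ is generated by $\alpha=\mathrm{diag}(\epsilon_m,\epsilon_m^r,\dots,\epsilon_m^{r^{s-1}})$ and $\beta$, where $\beta e_k=e_{k+1}$ for $1\le k\le s-1$ and $\beta e_s=\epsilon_m^te_1$. $A=\langle\alpha\rangle$ is normal, cyclic of order $m$, and $G/A$ is cyclic of order $s$ generated by the class of $\beta$. Put $c=\sum_{k=0}^{s-1}r^k$ and $V=\mathbb C^s$ (natural representation). $G'$, $A'$ are the images of $G$, $A$ under $\mathrm{GL}(s,\mathbb C)\hookrightarrow\mathrm{SL}(s+1,\mathbb C)$, $X\mapsto\mathrm{diag}(X,\det(X)^{-1})$,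 and $W=\mathbb C^{s+1}=V\oplus\det_V^{-1}$ is the natural representation. Representations. $S_i=\mathbb Cv_i$ ($i\in\mathbb Z/m\mathbb Z$) is the representation of $A$ with $\alpha v_i=\epsilon_m^iv_i$; $T_i=\mathrm{Ind}_A^G(S_i)$ has basis $v_i,\beta v_i,\dots,\beta^{s-1}v_i$ (with $\beta^sv_i=\epsilon_m^{ti}v_i$); $V=T_1$. $G/A$ acts on $\mathbb Z/m\mathbb Z$ by $i\mapsto ri$; $\mathcal F$ is the set of fixed points and $\mathcal D\supseteq\mathcal F$ a fixed set of representatives of the orbits, assumed closed under $i\mapsto i+c$. For $i\in\mathcal F$, $0\le\ell\le s-1$: $\eta_i$ is a fixed $s$-th root of $\epsilon_m^{ti}$, $\lambda_{i,\ell}=\eta_i\epsilon_s^\ell$, $w_i^{(\ell)}=\sum_{k=0}^{s-1}\lambda_{i,\ell}^{s-1-k}\beta^kv_i$, $T_i^{(\ell)}=\mathbb Cw_i^{(\ell)}$, and $T_i=\bigoplus_\ell T_i^{(\ell)}$. The irreducible representations of $G$ are $T_i$ ($i\in\mathcal D\smallsetminus\mathcal F$) and $T_i^{(\ell)}$ ($i\in\mathcal F$). $Q_A$ and $Q_{A'}$. $Q_A$ has vertices $\mathbb Z/m\mathbb Z$ and arrows $x_q^i\colon i\to i-r^q$ for $0\le q\le s-1$. $Q_{A'}$ (the McKay quiver of $A'$ relative to $W$) is $Q_A$ with an added arrow $y^i\colon i\to i+c$ for each $i$. The superpotential $\omega_{A'}$ is the sum, with signs given by the order of the arrow types, of all paths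 of length $s+1$ which contain exactly one arrow of each of the types $x_0,\dots,x_{s-1},y$, with arbitrary starting vertex and in arbitrary order. $Q_G$. Vertices $i$ (for $T_i$, $i\in\mathcal D\smallsetminus\mathcal F$) and $i^{(\ell)}$ (for $T_i^{(\ell)}$, $i\in\mathcal F$). Arrows (indices $p,a\in\{0,\dots,s-1\}$, read modulo $s$): (1) for $i,j\in\mathcal D\smallsetminus\mathcal F$, $x^i_{p,a}\colon i\to j$ whenever $r^aj\equiv i-r^p$, representing the $G$-map $T_i\to V\otimes T_j$, $v_i\mapsto\beta^pv_1\otimes\beta^av_j$; (2) for $i\in\mathcal D\smallsetminus\mathcal F$, $j\in\mathcal F$, $x^{i(\ell)}_{p,0}\colon i\to j^{(\ell)}$ whenever $j\equiv i-r^p$, representing the map $T_i\to V\otimes T_j$, $v_i\mapsto\beta^pv_1\otimes v_j$, followed by the projection $V\otimes T_j\to V\otimes T_j^{(\ell)}$; (3) for $i\in\mathcal F$, $j\in\mathcal D\smallsetminus\mathcal F$, $x^{(\ell)i}_{p,0}\colon i^{(\ell)}\to j$ whenever $j\equiv i-r^p$, representing the restriction to $T_i^{(\ell)}$ of $T_i\to V\otimes T_j$, $v_i\mapsto\beta^pv_1\otimes v_j$. There are no arrows between vertices coming from $\mathcal F$. (So arrows $S\to T$ form a basis of $\mathrm{Hom}_G(S,V\otimes T)$.) $Q_{G'}$ and $\omega_{G'}$. For $S\in\mathrm{Irr}(G)$ let $\tau(S)\in\mathrm{Irr}(G)$ be isomorphic to $\det_V\otimes S$. $Q_{G'}$ (McKay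 quiver of $G'$ relative to $W$) is $Q_G$ with one added arrow $S\to\tau(S)$ for each vertex $S$, representing a basis element of the one-dimensional space $\mathrm{Hom}_G(S,\det_V^{-1}\otimes\tau(S))\subseteq\mathrm{Hom}_G(S,W\otimes\tau(S))$. For a path $p\colon S_1\xrightarrow{a_1}S_2\to\cdots\xrightarrow{a_{s+1}}S_{s+2}$ in $Q_{G'}$, the composition $S_1\to W\otimes S_2\to\cdots\to W^{\otimes(s+1)}\otimes S_{s+2}\to\bigwedge^{s+1}W\otimes S_{s+2}\cong S_{s+2}$ (last map induced by the antisymmetrizer) is multiplication by a scalar $c_p$, and $\omega_{G'}=\sum_pc_p\dim(S_{s+2})p$ over paths of length $s+1$. $\tilde Q_G$ and $\tilde Q_{G'}$. $\tilde Q_G$ has vertices $\mathcal D$; arrows: for $i,j\in\mathcal D\smallsetminus\mathcal F$ the same $x^i_{p,a}$ as in $Q_G$; for exactly one of $i,j$ in $\mathcal F$, an arrow $x^i_{p,0}\colon i\to j$ whenever $j\equiv i-r^p$ for some $p$. $\tilde Q_{G'}$ is $\tilde Q_G$ with an added arrow $i\to i+c$ for each $i\in\mathcal D$. $\Phi'$. For $i\in\mathbb Z/m\mathbb Z$ let $\underline i\in\mathcal D$ be the representative of its orbit and $\kappa_i\in\{0,\dots,s-1\}$ with $r^{\kappa_i}\underline i\equiv i$ (unique if $i\notin\mathcal F$; $\kappa_i:=0$ if $i\in\mathcal F$). $\Phi'(i)=\underline i$; $\Phi'(x^i_q)=x^{\underline i}_{p,a}\colon \underline i\to\underline{i-r^q}$,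 where $(p,a)=(q-\kappa_i,\kappa_{i-r^q}-\kappa_i)$ if $\underline i,\underline{i-r^q}\notin\mathcal F$; $(p,a)=(q-\kappa_i,0)$ if $\underline i\notin\mathcal F$, $\underline{i-r^q}\in\mathcal F$; $(p,a)=(q-\kappa_{i-r^q},0)$ if $\underline i\in\mathcal F$, $\underline{i-r^q}\notin\mathcal F$; and $\Phi'(y^i)$ is the added arrow $\underline i\to\underline i+c$. *)

(* Defs.v *)
From HB Require Import structures.
From mathcomp Require Import all_boot all_order all_algebra all_fingroup.
From mathcomp Require Import boolp classical_sets reals complex.

Set Implicit Arguments.
Unset Strict Implicit.
Unset Printing Implicit Defensive.

Import GRing.Theory.
Local Open Scope ring_scope.

(* Arrows need not form a finite type here: no definition below sums over
   them, and an element of the path algebra is given by its coefficients. *)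
Record quiver := Quiver {
  vert : Type;
  arr : Type;
  src : arr -> vert;
  tgt : arr -> vert }.

(* [qpath Q x y n]: paths of length n from x to y; the arrow traversed first
   is the head. *)
Inductive qpath (Q : quiver) : vert Q -> vert Q -> nat -> Type :=
| PNil x : qpath x x 0
| PCons (b : arr Q) y n : qpath (tgt b) y n -> qpath (src b) y n.+1.

Fixpoint arrows (Q : quiver) x y n (p : @qpath Q x y n) : seq (arr Q) :=
  match p with
  | PNil _ => [::]
  | PCons b _ _ p' => b :: arrows p'
  end.

Definition grading (Q : quiver) := arr Q -> int.

Definition deg (Q : quiver) (g : grading Q) x y n (p : @qpath Q x y n) : int :=
  \sum_(b <- arrows p) g b.

(* An element of the path algebra supported on paths of length n, given by
   its coefficients. *)
Definition path_elt (Q : quiver) (K : Type) (n : nat) :=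
  forall x y : vert Q, qpath x y n -> K.

Definition homogeneous (Q : quiver) (K : nmodType) n (g : grading Q)
    (om : path_elt Q K n) (d : int) :=
  forall x y (p : qpath x y n), om x y p != 0 -> deg g p = d.

Record qmorph (Q Q' : quiver) := QMorph {
  mvert : vert Q -> vert Q';
  marr : arr Q -> arr Q';
  msrc : forall b, src (marr b) = mvert (src b);
  mtgt : forall b, tgt (marr b) = mvert (tgt b) }.

Definition gradable (Q Q' : quiver) (phi : qmorph Q Q') (g : grading Q) :=
  forall (b : arr Q') (b1 b2 : arr Q),
    marr phi b1 = b -> marr phi b2 = b -> g b1 = g b2.

(* If every arrow b carries a linear map src b -> W ⊗ tgt b, given by its
   components [M b w] along a basis (e_w) of W, then [path_map M p] is the
   composite x -> W ⊗ x_2 -> W ⊗ W ⊗ x_3 -> ... -> W^{⊗ n} ⊗ y along p;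
   its component at u is the one along e_{u_1} ⊗ ... ⊗ e_{u_n}. *)
Fixpoint path_map (Q : quiver) (K : fieldType) (N : nat) (dim : vert Q -> nat)
    (M : forall b : arr Q, 'I_N -> 'M[K]_(dim (tgt b), dim (src b)))
    x y n (p : @qpath Q x y n) : n.-tuple 'I_N -> 'M[K]_(dim y, dim x) :=
  match p in qpath x y n return n.-tuple 'I_N -> 'M[K]_(dim y, dim x) with
  | PNil _ => fun _ => 1%:M
  | PCons b _ _ p' => fun u => path_map M p' (behead_tuple u) *m M b (thead u)
  end.

(* The map U -> Λ^N W ⊗ S ≅ S induced by f : U -> W^{⊗ N} ⊗ S, where N = dim W
   and Λ^N W is identified with the ground field by e_1 ∧ ... ∧ e_N. *)
Definition antisym (K : fieldType) N k l
    (f : N.-tuple 'I_N -> 'M[K]_(k, l)) : 'M[K]_(k, l) :=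
  \sum_(u : 'S_N) (-1) ^+ u *: f [tuple u i | i < N].

(* Residues mod m are elements of 'Z_m. The library makes 'Z_1 (and 'Z_0)
   a ring with two elements; m = 1 is excluded wherever it matters by the
   hypothesis r <> 1 %[mod m]. *)
Section Residues.

Variables (m r s : nat).

Definition rmul (i : 'Z_m) : 'Z_m := r%:R * i.

Definition FixPts : {set 'Z_m} := [set i | rmul i == i].

Definition orbit_reps (D : {set 'Z_m}) :=
  forall i : 'Z_m, exists! j, j \in D /\ fconnect rmul i j.

Definition cc : 'Z_m := \sum_(0 <= k < s) r%:R ^+ k.

(* [x_q^i] and [y^i] *)
Inductive arrA := XA (i : 'Z_m) (q : 'I_s) | YA (i : 'Z_m).

Definition srcA (b : arrA) : 'Z_m :=
  match b with XA i _ => i | YA i => i end.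
Definition tgtA (b : arrA) : 'Z_m :=
  match b with XA i q => i - r%:R ^+ q | YA i => i + cc end.

Definition QA' := Quiver srcA tgtA.

(* The type of x_q is q, that of y comes last. *)
Definition typeA (b : arrA) : 'I_s.+1 :=
  match b with XA _ q => widen_ord (leqnSn s) q | YA _ => ord_max end.

Definition omegaA (K : fieldType) : path_elt QA' K s.+1 := fun x y p =>
  \sum_(u : 'S_s.+1 |
      [seq typeA b | b <- arrows p] == [seq u k | k <- enum 'I_s.+1])
    (-1) ^+ u.

Variable D : {set 'Z_m}.

Definition vertD := {i : 'Z_m | i \in D}.
Definition vertN := {i : 'Z_m | i \in D :\: FixPts}.
Definition vertF := {i : 'Z_m | i \in FixPts}.

Hypothesis D_cc : forall i, i \in D -> i + cc \in D.

Definition shiftD (i : vertD) : vertD := Sub (val i + cc) (D_cc (valP i)).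

(* [XT] : x^i_{p,a} between vertices outside FixPts;
   [XTF] : x^i_{p,0} with exactly one end in FixPts;
   [YT] : the added arrow i -> i + c. *)
Inductive arrGt :=
| XT (i j : vertD) (p a : 'I_s) of
    val i \notin FixPts & val j \notin FixPts &
    r%:R ^+ a * val j == val i - r%:R ^+ p
| XTF (i j : vertD) (p : 'I_s) of
    (val i \in FixPts) (+) (val j \in FixPts) & val j == val i - r%:R ^+ p
| YT (i : vertD).

Definition srcGt (b : arrGt) : vertD :=
  match b with XT i _ _ _ _ _ _ => i | XTF i _ _ _ _ => i | YT i => i end.
Definition tgtGt (b : arrGt) : vertD :=
  match b with
  | XT _ j _ _ _ _ _ => j | XTF _ j _ _ _ => j | YT i => shiftD i
  end.

Definition QGt' := Quiver srcGt tgtGt.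

Definition orep (i : 'Z_m) : 'Z_m :=
  odflt i [pick j in D | fconnect rmul i j].

Definition kappa (i : 'Z_m) : nat :=
  if i \in FixPts then 0%N else
  if [pick k : 'I_s | r%:R ^+ k * orep i == i] is Some k then val k else 0%N.

Hypothesis s_gt0 : (0 < s)%N.

(* p - k modulo s, for k <= s *)
Definition ord_sub (p k : nat) : 'I_s :=
  Ordinal (ltn_pmod (p + (s - k)) s_gt0).

Hypotheses (m_gt0 : (0 < m)%N) (rs1 : r ^ s = 1 %[mod m]).
Hypotheses (r_neq1 : r <> 1 %[mod m]) (D_reps : orbit_reps D).

Lemma m_gt1 : (1 < m)%N.
Proof. by case: m m_gt0 r_neq1 => [|[|n]] //; rewrite !modn1. Qed.

Lemma natr_eq (a b : nat) : a = b %[mod m] <-> a%:R = b%:R :> 'Z_m.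
Proof.
split=> [e|/(congr1 (@nat_of_ord _))]; last by rewrite !(val_Zp_nat m_gt1).
by apply: val_inj; rewrite /= !(val_Zp_nat m_gt1).
Qed.

Lemma rsE : r%:R ^+ s = 1 :> 'Z_m.
Proof. by rewrite -natrX (iffLR (natr_eq _ 1) rs1). Qed.

Lemma rN1 : r%:R != 1 :> 'Z_m.
Proof. by apply/eqP => e; apply: r_neq1; apply: (iffRL (natr_eq _ 1)). Qed.

Lemma rXK n (i : 'Z_m) : (n <= s)%N -> r%:R ^+ (s - n) * (r%:R ^+ n * i) = i.
Proof. by move=> le_ns; rewrite mulrA -exprD subnK // rsE mul1r. Qed.

Lemma rXmod n : r%:R ^+ (n %% s) = r%:R ^+ n :> 'Z_m.
Proof. by rewrite {2}(divn_eq n s) exprD mulnC exprM rsE expr1n mul1r. Qed.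

Lemma iter_rmul n i : iter n rmul i = r%:R ^+ n * i.
Proof. by elim: n => [|n IH] /=; rewrite ?mul1r // IH /rmul mulrA -exprS. Qed.

Lemma rmul_inj : injective rmul.
Proof.
move=> i j e; rewrite -(rXK i s_gt0) -(rXK j s_gt0) !expr1.
by rewrite -/(rmul i) e.
Qed.

Lemma orepP i : orep i \in D /\ fconnect rmul i (orep i).
Proof.
rewrite /orep; case: pickP => [j /andP[]//|no]; have [j [[jD ij] _]] := D_reps i.
by have := no j; rewrite jD ij.
Qed.

Lemma orep_uniq i j : j \in D -> fconnect rmul i j -> orep i = j.
Proof.
move=> jD ij; have [k [_ kuniq]] := D_reps i.
by rewrite -(kuniq _ (orepP i)); apply: kuniq.
Qed.

Lemma FixX n i : i \in FixPts -> r%:R ^+ n * i = i.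
Proof.
rewrite inE => /eqP iF; elim: n => [|n IH]; first by rewrite mul1r.
by rewrite exprS -mulrA IH.
Qed.

Lemma orep_FixPts i : (orep i \in FixPts) = (i \in FixPts).
Proof.
have [_ ij] := orepP i; have e := iter_findex ij.
apply/idP/idP => h; last by rewrite -e iter_rmul FixX.
move: ij; rewrite fconnect_sym; last exact: rmul_inj.
by move=> /iter_findex; rewrite iter_rmul FixX // => <-.
Qed.

Lemma orep_id i : i \in FixPts -> orep i = i.
Proof.
by move=> iF; have [_ /iter_findex] := orepP i; rewrite iter_rmul FixX.
Qed.

Lemma kappaP i : r%:R ^+ kappa i * orep i = i.
Proof.
rewrite /kappa; case: ifPn => [iF|iF]; first by rewrite mul1r orep_id.
case: pickP => [k /eqP //|no]; have [_] := orepP i.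
rewrite fconnect_sym; last exact: rmul_inj.
move=> /iter_findex; set n := findex _ _ _; rewrite iter_rmul => e.
by have := no (Ordinal (ltn_pmod n s_gt0)); rewrite /= rXmod e eqxx.
Qed.

Lemma kappa_le i : (kappa i <= s)%N.
Proof.
rewrite /kappa; case: ifP => // _.
by case: pickP => [k _|_] //; apply: ltnW (ltn_ord k).
Qed.

Lemma ord_subE p k : r%:R ^+ ord_sub p k = r%:R ^+ (s - k) * r%:R ^+ p :> 'Z_m.
Proof. by rewrite /= rXmod addnC exprD. Qed.

Definition orepD (i : 'Z_m) : vertD := Sub (orep i) (proj1 (orepP i)).

Lemma xor_FT (b1 b2 : bool) : ~ b1 -> b2 -> b1 (+) b2.
Proof. by case: b1; case: b2. Qed.

Lemma xor_TF (b1 b2 : bool) : b1 -> ~ b2 -> b1 (+) b2.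
Proof. by case: b1; case: b2 => // _ []. Qed.

Lemma Phi_nn i q :
  r%:R ^+ ord_sub (kappa (i - r%:R ^+ q)) (kappa i) * orep (i - r%:R ^+ q)
    == orep i - r%:R ^+ ord_sub q (kappa i).
Proof.
rewrite !ord_subE; set j := i - _; rewrite -mulrA kappaP /j mulrBr.
apply/eqP; congr (_ - _).
by rewrite -[X in _ * X]kappaP rXK ?kappa_le.
Qed.

Lemma Phi_nf i q : orep (i - r%:R ^+ q) \in FixPts ->
  orep (i - r%:R ^+ q) == orep i - r%:R ^+ ord_sub q (kappa i).
Proof.
move=> jF; have /eqP <- := Phi_nn i q.
by rewrite FixX.
Qed.

Lemma Phi_fn i q : orep i \in FixPts ->
  orep (i - r%:R ^+ q)
    == orep i - r%:R ^+ ord_sub q (kappa (i - r%:R ^+ q)).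
Proof.
rewrite orep_FixPts => iF; rewrite ord_subE (orep_id iF); set j := i - _.
by rewrite -[X in X == _](rXK _ (kappa_le j)) kappaP /j mulrBr FixX.
Qed.

Lemma Phi_ff i (q : 'I_s) :
  orep i \in FixPts -> orep (i - r%:R ^+ q) \in FixPts -> False.
Proof.
rewrite !orep_FixPts !inE /rmul => /eqP iF; rewrite mulrBr iF => /eqP.
move=> /addrI /oppr_inj; rewrite -exprS exprSr => e; case/eqP: rN1.
rewrite -[RHS](rXK 1 (ltnW (ltn_ord q))) mulr1 -[in RHS]e.
by rewrite rXK // ltnW.
Qed.

Definition PhiX_case (i : 'Z_m) (q : 'I_s) (b1 b2 : bool)
    (iP : reflect (val (orepD i) \in FixPts) b1)
    (jP : reflect (val (orepD (i - r%:R ^+ q)) \in FixPts) b2) : arrGt :=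
  match iP, jP with
  | ReflectF iF, ReflectF jF =>
      @XT (orepD i) (orepD (i - r%:R ^+ q)) (ord_sub q (kappa i))
        (ord_sub (kappa (i - r%:R ^+ q)) (kappa i))
        (introN idP iF) (introN idP jF) (Phi_nn i q)
  | ReflectF iF, ReflectT jF =>
      @XTF (orepD i) (orepD (i - r%:R ^+ q)) (ord_sub q (kappa i))
        (xor_FT iF jF) (Phi_nf jF)
  | ReflectT iF, ReflectF jF =>
      @XTF (orepD i) (orepD (i - r%:R ^+ q))
        (ord_sub q (kappa (i - r%:R ^+ q))) (xor_TF iF jF) (Phi_fn q iF)
  | ReflectT iF, ReflectT jF => False_rect _ (Phi_ff iF jF)
  end.

Definition PhiX (i : 'Z_m) (q : 'I_s) : arrGt := @PhiX_case i q _ _ idP idP.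

Definition PhiA (b : arrA) : arrGt :=
  match b with XA i q => PhiX i q | YA i => YT (orepD i) end.

Lemma PhiA_src b : srcGt (PhiA b) = orepD (srcA b).
Proof.
case: b => [i q|i] //=; rewrite /PhiX.
by case: idP => iF; case: idP => jF //; case: (Phi_ff iF jF).
Qed.

Lemma PhiA_tgt b : tgtGt (PhiA b) = orepD (tgtA b).
Proof.
case: b => [i q|i] /=.
  rewrite /PhiX.
  by case: idP => iF; case: idP => jF //; case: (Phi_ff iF jF).
apply: val_inj => /=; apply/esym/orep_uniq.
  by apply: D_cc; case: (orepP i).
have [_ /iter_findex <-] := orepP i; set n := findex _ _ _.
have ccF : cc \in FixPts.
  rewrite inE /rmul /cc mulr_sumr.
  under eq_bigr do rewrite -exprS.
  rewrite -(prednK s_gt0) big_nat_recr //= [X in _ == X]big_nat_recl //=.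
  by rewrite addrC prednK // rsE expr0.
rewrite iter_rmul -(FixX n ccF) -mulrDr -iter_rmul FixX //.
exact: fconnect_iter.
Qed.

Definition Phi' : qmorph QA' QGt' :=
  @QMorph QA' QGt' orepD PhiA PhiA_src PhiA_tgt.

End Residues.

Section Representations.

Variables (C : fieldType) (m r s t : nat) (eps epss : C).

Definition alpha : 'M[C]_s := diag_mx (\row_k eps ^+ (r ^ k)).

Definition beta : 'M[C]_s :=
  \matrix_(k, l) if l.+1 == s then eps ^+ t *+ (k == 0 :> nat)
                 else (k == l.+1 :> nat)%:R.

(* Matrices act on column vectors. *)
Inductive inG : 'M[C]_s -> Prop :=
| G_alpha : inG alpha
| G_beta : inG beta
| G_one : inG 1%:M
| G_mul g h : inG g -> inG h -> inG (g *m h)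
| G_inv g : inG g -> inG (invmx g).

(* T_i = Ind_A^G S_i in the basis v_i, β v_i, ..., β^{s-1} v_i:
   g β^l v_i = β^k (β^-k g β^l) v_i for the k such that β^-k g β^l is in A,
   and then β^-k g β^l = α^n acts on v_i by ε_m^{i n}. *)
Definition indT (i : 'Z_m) (g : 'M[C]_s) : 'M[C]_s :=
  \matrix_(k, l)
    if [pick n : 'I_m | g *m beta ^+ l == beta ^+ k *m alpha ^+ n] is Some n
    then eps ^+ (i * n) else 0.

Definition is_hom k l (rho : 'M[C]_s -> 'M[C]_k) (rho' : 'M[C]_s -> 'M[C]_l)
    (f : 'M[C]_(l, k)) :=
  forall g, inG g -> f *m rho g = rho' g *m f.

Definition rep_iso k l (rho : 'M[C]_s -> 'M[C]_k) (rho' : 'M[C]_s -> 'M[C]_l) :=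
  exists f : 'M[C]_(l, k), exists f' : 'M[C]_(k, l),
    [/\ is_hom rho rho' f, f' *m f = 1%:M & f *m f' = 1%:M].

Definition det_tensor k (rho : 'M[C]_s -> 'M[C]_k) (g : 'M[C]_s) : 'M[C]_k :=
  \det g *: rho g.

Definition detinv_tensor k (rho : 'M[C]_s -> 'M[C]_k) (g : 'M[C]_s) : 'M[C]_k :=
  (\det g)^-1 *: rho g.

Variables (eta : 'Z_m -> C) (D : {set 'Z_m}).

(* The l-th column is w_i^{(l)} = \sum_k λ_{i,l}^{s-1-k} β^k v_i; hence, for i
   in FixPts, row l of the inverse is the projection T_i -> T_i^{(l)} along the
   other summands, in the basis w_i^{(l)} of its image. *)
Definition wmx (i : 'Z_m) : 'M[C]_s :=
  \matrix_(k, l) (eta i * epss ^+ l) ^+ (s.-1 - k).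

Definition incl_w (i : 'Z_m) (l : 'I_s) : 'M[C]_(s, 1) := col l (wmx i).
Definition proj_w (i : 'Z_m) (l : 'I_s) : 'M[C]_(1, s) := row l (invmx (wmx i)).

(* [inl i] stands for T_i, [inr (i, l)] for T_i^{(l)}. *)
Definition vertG := (vertN r D + vertF m r * 'I_s)%type.

Definition dimG (S : vertG) : nat := match S with inl _ => s | inr _ => 1 end.

Definition rhoG (S : vertG) : 'M[C]_s -> 'M[C]_(dimG S) :=
  match S with
  | inl i => indT (val i)
  | inr (i, l) => fun g => proj_w (val i) l *m indT (val i) g *m incl_w (val i) l
  end.

(* coordinates of v_i in T_i, for any i *)
Definition vgen : 'cV[C]_s := \col_k (k == 0 :> nat)%:R.

(* The component along β^w v_1 of the G-map T_i -> V ⊗ T_j sending v_i to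
   β^p v_1 ⊗ β^a v_j, hence β^k v_i to β^{k+p} v_1 ⊗ β^{k+a} v_j. *)
Definition Gmap (j : 'Z_m) (p a : nat) (w : 'I_s) : 'M[C]_s :=
  \matrix_(u, k) ((beta ^+ (k + p) *m vgen) w 0
                  * (indT j beta ^+ (k + a) *m vgen) u 0).

(* [YG S] is the added arrow S -> τ(S). *)
Inductive arrG :=
| XG (i j : vertN r D) (p a : 'I_s) of
    r%:R ^+ a * val j == val i - r%:R ^+ p
| XGin (i : vertN r D) (j : vertF m r) (l p : 'I_s) of
    val j == val i - r%:R ^+ p
| XGout (i : vertF m r) (l : 'I_s) (j : vertN r D) (p : 'I_s) of
    val j == val i - r%:R ^+ p
| YG (S : vertG).

Variable tau : vertG -> vertG.

Definition srcG (b : arrG) : vertG :=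
  match b with
  | XG i _ _ _ _ => inl i
  | XGin i _ _ _ _ => inl i
  | XGout i l _ _ _ => inr (i, l)
  | YG x => x
  end.

Definition tgtG (b : arrG) : vertG :=
  match b with
  | XG _ j _ _ _ => inl j
  | XGin _ j l _ _ => inr (j, l)
  | XGout _ _ j _ _ => inl j
  | YG x => tau x
  end.

Definition QG' := Quiver srcG tgtG.

Variable theta : forall S : vertG, 'M[C]_(dimG (tau S), dimG S).

(* The basis of W = V ⊕ det_V^-1 is indexed by 'I_s.+1: first the basis
   v_1, β v_1, ..., β^{s-1} v_1 of V = T_1, and then ([ord_max]) a basis
   element of det_V^-1. *)
Definition arrG_map (b : arr QG') (w : 'I_s.+1) :
    'M[C]_(dimG (tgt b), dimG (src b)) :=
  match b return 'M[C]_(dimG (tgtG b), dimG (srcG b)) with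
  | XG i j p a _ =>
      if unlift ord_max w is Some k then Gmap (val j) p a k else 0
  | XGin i j l p _ =>
      if unlift ord_max w is Some k then proj_w (val j) l *m Gmap (val j) p 0 k
      else 0
  | XGout i l j p _ =>
      if unlift ord_max w is Some k then Gmap (val j) p 0 k *m incl_w (val i) l
      else 0
  | YG x => if w == ord_max then theta x else 0
  end.

(* The scalar c_p. For a closed path, the equation inside [xget] says that the
   composite is multiplication by z (the entrywise form avoids a cast along
   x = y). By Schur's lemma such a z exists (hence [xget] never returns its
   default value), and the composite vanishes for x <> y. *)
Definition path_scalar x y (p : @qpath QG' x y s.+1) : C :=
  if x == y then
    xget 0 [set z | antisym (@path_map QG' C _ dimG arrG_map _ _ _ p)
                    = \matrix_(u, v) (z *+ (u == v :> nat))]%classic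
  else 0.

Definition omegaG : path_elt QG' C s.+1 := fun x y p =>
  path_scalar p * (dimG y)%:R.

End Representations.

(* Main.v *)
(* The basis vectors of the T_i and T_i^(l) are weight vectors for A: alpha
   multiplies beta^k v_i by eps^(r^k i) and T_i^(l) by eps^i. A nonzero matrix
   entry of the component along e_w of an arrow of Q_G' therefore joins two
   weights i and i - r^w (or i and i + c when e_w spans det^-1), so it singles
   out an arrow of Q_A' of type w, whose image under Phi' does not depend on the
   chosen entry. Gradability of Phi' thus makes its g_A-degree a function g_G of
   the arrow of Q_G'. Now let p be a path with c_p <> 0. Some term of its
   antisymmetrization has a nonzero entry, which lifts p arrow by arrow to a path
   of Q_A' of the same degree containing each arrow type exactly once, that is, a
   path in the support of omega_A'. *)

Require Import Defs.
From mathcomp Require Import all_boot all_order all_algebra all_fingroup.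
From mathcomp Require Import boolp classical_sets reals complex.

Import GRing.Theory.
Local Open Scope ring_scope.
Local Open Scope complex_scope.

Lemma mulmx_neq0 {K : fieldType} p q n (A : 'M[K]_(p, q)) (B : 'M[K]_(q, n)) x y :
  (A *m B) x y != 0 -> exists2 z, A x z != 0 & B z y != 0.
Proof.
rewrite mxE => /eqP sum0.
have [j|j0] := pickP [pred j | A x j * B j y != 0]; last first.
  by case: sum0; apply: big1 => j _; move/negbFE/eqP: (j0 j).
by rewrite inE mulf_eq0 negb_or => /andP[]; exists j.
Qed.

(** * Weights of [alpha] and supports of [beta] on the induced representations *)

Section Weights.

Context {C : fieldType} {m r s : nat} (t : nat) {eps : C}.
Hypotheses (m_gt0 : (0 < m)%N) (r_neq1 : (r <> 1 %[mod m])%N).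
Hypotheses (s_gt0 : (0 < s)%N) (rs1 : (r ^ s = 1 %[mod m])%N).
Hypothesis eps_prim : m.-primitive_root eps.

Local Notation alpha := (alpha r s eps).
Local Notation beta := (beta s t eps).
Local Notation vgen := (vgen C s).

(** Exponents in 'Z_m are read through representatives; as [eps] has order m, reduction modulo m
    does not change the power. *)
Lemma chi_nat n : eps ^+ (n%:R : 'Z_m) = eps ^+ n.
Proof. by rewrite (val_Zp_nat (m_gt1 m_gt0 r_neq1)) (prim_expr_mod eps_prim). Qed.

Lemma chiD (x y : 'Z_m) : eps ^+ (x + y)%R = eps ^+ x * eps ^+ y.
Proof. by rewrite -{1}(natr_Zp x) -{1}(natr_Zp y) -natrD chi_nat exprD. Qed.

Lemma chiM (x y : 'Z_m) : eps ^+ (x * y)%R = eps ^+ (x * y)%N.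
Proof. by rewrite -{1}(natr_Zp x) -{1}(natr_Zp y) -natrM chi_nat. Qed.

Lemma chi_inj (x y : 'Z_m) : eps ^+ x = eps ^+ y -> x = y.
Proof.
move/eqP; rewrite (eq_prim_root_expr eps_prim) => /eqP.
by move/(iffLR (natr_eq m_gt0 r_neq1 _ _)); rewrite !natr_Zp.
Qed.

Lemma chi_rX n : eps ^+ (r ^ n) = eps ^+ (r%:R ^+ n : 'Z_m)%R.
Proof. by rewrite -natrX chi_nat. Qed.

Lemma eps_neq0 : eps != 0.
Proof.
apply/eqP => e0; have := prim_expr_order eps_prim.
by rewrite e0 expr0n gtn_eqF // => /esym/eqP; rewrite oner_eq0.
Qed.

(* [beta ^+ n *m vgen] up to a nonzero scalar *)
Definition evec n : 'cV[C]_s := \col_(k < s) (k == (n %% s)%N :> nat)%:R.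

Lemma evec_eqmod a b (c d : C) :
  c != 0 -> c *: evec a = d *: evec b -> (a = b %[mod s])%N.
Proof.
move=> c0 /matrixP /(_ (Ordinal (ltn_pmod a s_gt0)) 0).
rewrite !mxE /= eqxx mulr1; case: eqP => // _ cE.
by rewrite cE mulr0 eqxx in c0.
Qed.

Lemma evec_inj n : injective (fun c : C => c *: evec n).
Proof.
move=> c d /matrixP /(_ (Ordinal (ltn_pmod n s_gt0)) 0).
by rewrite !mxE /= eqxx !mulr1.
Qed.

Lemma beta_evec n : exists2 c, c != 0 & beta *m evec n = c *: evec n.+1.
Proof.
(* The shift wraps around at the last basis vector, where [beta] has the entry [eps ^+ t]. *)
exists (if (n %% s)%N.+1 == s then eps ^+ t else 1).
  by case: ifP; rewrite ?expf_neq0 ?eps_neq0 ?oner_eq0.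
apply/colP => k; rewrite !mxE (bigD1 (Ordinal (ltn_pmod n s_gt0))) //= big1.
  rewrite !mxE /= eqxx mulr1 addr0.
  rewrite -(addn1 n) -modnDml addn1; case: eqP => [->|/eqP ns].
    by rewrite modnn mulr_natr.
  have lt_s : ((n %% s).+1 < s)%N by rewrite ltn_neqAle ns ltn_pmod.
  by rewrite (modn_small lt_s) mul1r.
by move=> l ln; rewrite !mxE -val_eqE /= in ln *; rewrite (negPf ln) mulr0.
Qed.

Lemma betaX_vgen n : exists2 c, c != 0 & beta ^+ n *m vgen = c *: evec n.
Proof.
elim: n => [|n [c c0 IH]].
  exists 1; rewrite ?oner_eq0 // expr0 mul1mx scale1r.
  by apply/colP => k; rewrite !mxE mod0n.
have [d d0 E] := beta_evec n.
exists (c * d); first by rewrite mulf_neq0.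
by rewrite exprS -mulmxA IH -scalemxAr E scalerA.
Qed.

Lemma alphaXE n : alpha ^+ n = diag_mx (\row_k eps ^+ (r ^ k * n)).
Proof.
elim: n => [|n IH].
  apply/matrixP => k l; rewrite expr0 !mxE muln0 expr0.
  by case: eqP.
rewrite exprS IH -[LHS]/(alpha *m _) mulmx_diag; congr diag_mx; apply/rowP => k.
by rewrite !mxE mulnS exprD.
Qed.

Lemma alphaX_evec n k :
  alpha ^+ n *m evec k = eps ^+ (r ^ k * n) *: evec k.
Proof.
rewrite alphaXE mul_diag_mx; apply/colP => l; rewrite !mxE.
case: eqP => [->|_]; last by rewrite !mulr0.
by rewrite !mulr1 !exprM !chi_rX (rXmod m_gt0 rs1 r_neq1).
Qed.

Lemma alpha_order : alpha ^+ m = 1%:M.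
Proof.
rewrite alphaXE; apply/matrixP => k l; rewrite !mxE.
by rewrite mulnC exprM (prim_expr_order eps_prim) expr1n.
Qed.

(** [beta] is supported where k is l + 1 modulo s; there r^k and r^(l+1) agree modulo m, at the
    corner because r^s = 1. *)
Lemma alphaX_beta n : alpha ^+ n *m beta = beta *m alpha ^+ (r * n).
Proof.
rewrite !alphaXE mul_diag_mx mul_mx_diag; apply/matrixP => k l; rewrite !mxE.
have [kl|kl] := eqVneq (k : nat) (l.+1 %% s)%N.
  rewrite mulrC exprM chi_rX kl (rXmod m_gt0 rs1 r_neq1) -chi_rX -exprM.
  by rewrite expnSr -mulnA.
suff -> : (if l.+1 == s then eps ^+ t *+ (k == 0%N :> nat)
           else (k == l.+1 :> nat)%:R) = 0 by rewrite mulr0 mul0r.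
case: (l.+1 =P s) kl => [->|/eqP ls]; first by rewrite modnn => /negPf ->.
have lt_s : (l.+1 < s)%N by rewrite ltn_neqAle ls ltn_ord.
by rewrite (modn_small lt_s) => /negPf ->.
Qed.

Lemma alpha_betaX l : alpha *m beta ^+ l = beta ^+ l *m alpha ^+ (r ^ l).
Proof.
elim: l => [|l IH]; first by rewrite expr0 mulmx1 mul1mx expr1.
by rewrite exprSr mulmxA IH -mulmxA alphaX_beta mulmxA expnS.
Qed.

Lemma indT_spec (i : 'Z_m) g (k l : 'I_s) : indT r t eps i g k l != 0 ->
  exists2 n : nat, g *m beta ^+ l = beta ^+ k *m alpha ^+ n
    & indT r t eps i g k l = eps ^+ (i * n).
Proof.
rewrite !mxE; case: pickP => [n /eqP E _|_]; last by rewrite eqxx.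
by exists n.
Qed.

Lemma alphaX_vgen n : alpha ^+ n *m vgen = eps ^+ n *: vgen.
Proof.
have -> : vgen = evec 0 by apply/colP => k; rewrite !mxE mod0n.
by rewrite alphaX_evec mul1n.
Qed.

(** The matrix identity of [indT_spec], applied to [vgen], equates multiples of two basis vectors,
    so their indices agree modulo s. *)
Lemma indT_beta_supp (i : 'Z_m) (k l : 'I_s) :
  indT r t eps i beta k l != 0 -> k = (l.+1 %% s)%N :> nat.
Proof.
case/indT_spec => n /(congr1 (fun M => M *m vgen)) E _.
move: E; rewrite -[beta *m beta ^+ l]/(beta * beta ^+ l) -exprS -mulmxA.
rewrite alphaX_vgen -scalemxAr.
have [c c0 ->] := betaX_vgen l.+1; have [d d0 ->] := betaX_vgen k.
rewrite scalerA => /(evec_eqmod _ _ _ _ c0) ->.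
by rewrite modn_small.
Qed.

(** As for [beta], but the scalars are compared too: they give [eps ^+ n = eps ^+ (r ^ k)], which
    determines the entry. *)
Lemma indT_alpha (i : 'Z_m) (k l : 'I_s) :
  indT r t eps i alpha k l = eps ^+ (r%:R ^+ k * i)%R *+ (k == l).
Proof.
have entry (x y : 'I_s) : indT r t eps i alpha x y != 0 ->
    x = y /\ indT r t eps i alpha x y = eps ^+ (r%:R ^+ x * i)%R.
  case/indT_spec => n /(congr1 (fun M => M *m vgen)) E ->.
  move: E; rewrite -!mulmxA alphaX_vgen -scalemxAr.
  have [c c0 yE] := betaX_vgen y; have [d d0 xE] := betaX_vgen x.
  rewrite yE -scalemxAr -[alpha]expr1 alphaX_evec muln1 xE !scalerA => E.
  have xy : x = y.
    apply: val_inj; rewrite /= -(modn_small (ltn_ord x)).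
    rewrite -(evec_eqmod _ _ _ _ _ E) ?mulf_neq0 ?expf_neq0 ?eps_neq0 //.
    by rewrite modn_small.
  subst y; split=> //; move: xE E; rewrite yE => /evec_inj ->.
  rewrite [d * _]mulrC => /evec_inj /(mulIf d0) E.
  by rewrite mulnC exprM -E chi_rX chiM exprM.
case: (eqVneq k l) => [->|kl]; last first.
  by apply/eqP; apply: contraNT kl => /entry [-> _].
rewrite mulr1n; apply: (entry l l _).2.
(* On the diagonal the choice in [indT] succeeds, r^l reduced modulo m being a witness; the entry is
   then a power of [eps]. *)
rewrite mxE; case: pickP => [n _|/(_ (Ordinal (ltn_pmod (r ^ l) m_gt0)))].
  by rewrite expf_neq0 ?eps_neq0.
by rewrite /= (expr_mod _ alpha_order) alpha_betaX eqxx.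
Qed.

(** Each factor moves the index by one modulo s. The matrix is left general to cover both [beta] and
    its action on T_j. *)
Lemma cyclicX_supp (M : 'M[C]_s) n (w : 'I_s) :
    (forall k l, M k l != 0 -> k = (l.+1 %% s)%N :> nat) ->
  (M ^+ n *m vgen) w 0 != 0 -> w = (n %% s)%N :> nat.
Proof.
move=> Mcyc; elim: n w => [|n IH] w.
  by rewrite expr0 mul1mx mxE mod0n; case: (w =P 0%N :> nat) => // _; rewrite eqxx.
rewrite exprS -mulmxA => /mulmx_neq0[j /Mcyc -> /IH ->].
by rewrite -addn1 modnDml addn1.
Qed.

Lemma Gmap_supp (j : 'Z_m) (p a : nat) (w u k : 'I_s) :
    Gmap r t eps j p a w u k != 0 ->
  w = ((k + p) %% s)%N :> nat /\ u = ((k + a) %% s)%N :> nat.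
Proof.
rewrite mxE mulf_eq0 negb_or => /andP[wP uP]; split.
  apply: cyclicX_supp wP => x y; rewrite mxE.
  case: (y.+1 =P s) => [->|/eqP ys]; rewrite ?modnn.
    by case: (x =P 0%N :> nat) => //; rewrite eqxx.
  have lt_s : (y.+1 < s)%N by rewrite ltn_neqAle ys ltn_ord.
  by rewrite (modn_small lt_s); case: (x =P y.+1 :> nat) => //; rewrite eqxx.
by apply: cyclicX_supp uP => x y; apply: indT_beta_supp.
Qed.

Lemma det_alpha : \det alpha = eps ^+ (cc m r s).
Proof.
rewrite det_diag /cc big_mkord.
rewrite (eq_bigr (fun k : 'I_s => eps ^+ (r%:R ^+ k : 'Z_m)%R)); last first.
  by move=> k _; rewrite mxE chi_rX.
elim/big_ind2: _ => [|x1 x2 y1 y2 -> ->|//]; first by rewrite expr0.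
by rewrite chiD.
Qed.

End Weights.

(** * The splitting of T_i at a fixed point *)

Section FixedPoints.

Context {C : fieldType} {m s : nat} {epss : C}.
Hypothesis epss_prim : s.-primitive_root epss.
Context {eta : 'Z_m -> C}.

(** Up to reversing the rows this is the Vandermonde matrix of the numbers [eta i * epss ^+ l],
    pairwise distinct since [epss] is primitive. *)
Lemma wmx_unit (i : 'Z_m) : eta i != 0 -> wmx s epss eta i \in unitmx.
Proof.
move=> eta0; pose lam := \row_(l < s) (eta i * epss ^+ l).
have -> : wmx s epss eta i
    = row_perm (perm rev_ord_inj) (Vandermonde s lam).
  by apply/matrixP => k l; rewrite !mxE permE /= -subn1 -subnDA add1n.
rewrite row_permE unitmxE det_mulmx det_perm unitrM; apply/andP; split.
  by rewrite unitfE signr_eq0.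
rewrite det_Vandermonde unitfE; apply/prodf_neq0 => k _; apply/prodf_neq0 => l kl.
rewrite !mxE -mulrBr mulf_neq0 // subr_eq0 (eq_prim_root_expr epss_prim).
by rewrite !modn_small // gtn_eqF.
Qed.

Lemma proj_incl_w (i : 'Z_m) (l : 'I_s) : eta i != 0 ->
  proj_w epss eta i l *m incl_w epss eta i l = 1%:M.
Proof.
move=> eta0; rewrite /proj_w /incl_w -row_mul colE mulmxA mulVmx ?wmx_unit // mul1mx.
by apply/matrixP => x y; rewrite !ord1 !mxE !eqxx.
Qed.

End FixedPoints.

(** * Orbits of multiplication by r, and the effect of Phi' along them *)

Section Orbits.

Context {m r s : nat} {D : {set 'Z_m}}.
Hypotheses (m_gt0 : (0 < m)%N) (r_neq1 : (r <> 1 %[mod m])%N).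
Hypotheses (s_gt0 : (0 < s)%N) (rs1 : (r ^ s = 1 %[mod m])%N).
Hypothesis s_prime : prime s.
Hypothesis D_reps : orbit_reps r D.

Lemma orep_rX n (i : 'Z_m) : i \in D -> orep r D (r%:R ^+ n * i) = i.
Proof.
move=> iD; apply: (orep_uniq D_reps iD).
rewrite fconnect_sym; last exact: rmul_inj s_gt0 m_gt0 rs1 r_neq1.
by rewrite -iter_rmul fconnect_iter.
Qed.

(* As s is prime, the stabiliser of i in <r> (of order s) is trivial or
   everything. *)
Lemma rX_id_FixPts d (i : 'Z_m) :
  (0 < d < s)%N -> r%:R ^+ d * i = i -> i \in FixPts m r.
Proof.
case/andP=> d0 ds rdi; have iterd n : r%:R ^+ (n * d) * i = i.
  elim: n => [|n IH]; first by rewrite mul1r.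
  by rewrite mulSn exprD -mulrA IH.
case: (egcdnP s d0) => u v; have /eqP -> : coprime d s.
  by rewrite coprime_sym prime_coprime // gtnNdvd.
move=> uv _; rewrite inE /rmul -{2}(iterd u) uv.
by rewrite exprD mulnC exprM (rsE m_gt0 rs1 r_neq1) expr1n mul1r expr1.
Qed.

(** If k < l, cancelling r^k would make r^(l-k) fix i, with 0 < l - k < s. *)
Lemma rX_inj (i : 'Z_m) (k l : nat) : i \notin FixPts m r -> (k < s)%N ->
  (l < s)%N -> r%:R ^+ k * i = r%:R ^+ l * i -> k = l.
Proof.
move=> iF; wlog kl : k l / (k <= l)%N.
  by move=> W ks ls e; case: (leqP k l) => [|/ltnW] kl; [|symmetry]; apply: W.
move=> ks ls e; apply/eqP; rewrite eqn_leq kl leqNgt; apply: contra iF => lt_kl.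
apply: (@rX_id_FixPts (l - k)).
  by rewrite subn_gt0 lt_kl (leq_ltn_trans (leq_subr _ _)).
rewrite -{2}(rXK m_gt0 rs1 r_neq1 i (ltnW ks)) e mulrA -exprD.
by rewrite -addnABC // ?(ltnW ks) // exprD (rsE m_gt0 rs1 r_neq1) mul1r.
Qed.

Lemma kappa_rX (k : nat) (i : 'Z_m) : i \in D -> i \notin FixPts m r ->
  kappa r s D (r%:R ^+ k * i) = (k %% s)%N.
Proof.
move=> iD iF; rewrite /kappa -(orep_FixPts s_gt0 m_gt0 rs1 r_neq1 D_reps).
rewrite orep_rX // (negPf iF); case: pickP => [l /eqP e|]; last first.
  move/(_ (Ordinal (ltn_pmod k s_gt0))).
  by rewrite /= (rXmod m_gt0 rs1 r_neq1) eqxx.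
apply: (rX_inj i) => //; [exact: ltn_ord | exact: ltn_pmod |].
by rewrite (rXmod m_gt0 rs1 r_neq1).
Qed.

Lemma ord_subK (w : 'I_s) (k p : nat) (p' : 'I_s) : p = p' -> (k < s)%N ->
  w = ((k + p) %% s)%N :> nat -> ord_sub s_gt0 w k = p'.
Proof.
move=> -> ks wE; apply: val_inj; rewrite /= wE modnDml.
by rewrite addnAC subnKC ?(ltnW ks) // modnDl modn_small.
Qed.

(** Arrows carry proofs of boolean conditions; by proof irrelevance only ends and indices have to be
    compared. *)
Lemma XT_congr {i j i' j' : vertD D} {p a p' a' : 'I_s} iF jF e iF' jF' e' :
  i = i' -> j = j' -> p = p' -> a = a' ->
  @XT m r s D i j p a iF jF e = @XT m r s D i' j' p' a' iF' jF' e'.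
Proof.
move=> *; subst; congr XT; exact: bool_irrelevance.
Qed.

Lemma XTF_congr {i j i' j' : vertD D} {p p' : 'I_s} iF e iF' e' :
  i = i' -> j = j' -> p = p' ->
  @XTF m r s D i j p iF e = @XTF m r s D i' j' p' iF' e'.
Proof.
move=> *; subst; congr XTF; exact: bool_irrelevance.
Qed.

Local Notation orep := (orep r D).
Local Notation kappa := (kappa r s D).
Local Notation PhiX := (PhiX s_gt0 m_gt0 rs1 r_neq1 D_reps).
Local Notation F := (FixPts m r).

Lemma orepD_congr (i i' : 'Z_m) :
  orep i = orep i' -> orepD D_reps i = orepD D_reps i'.
Proof. by move=> e; apply: val_inj. Qed.

Lemma PhiX_congr (i i' : 'Z_m) (q q' : 'I_s) :
  let j := i - r%:R ^+ q in let j' := i' - r%:R ^+ q' in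
  orep i = orep i' -> orep j = orep j' ->
  (orep i \notin F ->
     ord_sub s_gt0 q (kappa i) = ord_sub s_gt0 q' (kappa i')) ->
  (orep i \in F ->
     ord_sub s_gt0 q (kappa j) = ord_sub s_gt0 q' (kappa j')) ->
  (orep i \notin F -> orep j \notin F ->
     ord_sub s_gt0 (kappa j) (kappa i) = ord_sub s_gt0 (kappa j') (kappa i')) ->
  PhiX i q = PhiX i' q'.
Proof.
move=> j j' iE jE e1 e2 e3; rewrite /Defs.PhiX.
(* Of the sixteen cases only the three with matching ends survive, two fixed ends being excluded by
   [Phi_ff]. *)
case: idP => iF; case: idP => jF; case: idP => iF'; case: idP => jF';
  try by [case: (Phi_ff s_gt0 m_gt0 rs1 r_neq1 D_reps iF jF)
         | case: iF'; rewrite /= -iE | case: iF; rewrite /= iE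
         | case: jF'; rewrite /= -jE | case: jF; rewrite /= jE].
- by apply: XTF_congr; [apply: orepD_congr..| apply: e2].
- by apply: XTF_congr; [apply: orepD_congr..| apply: e1; apply/negP].
- by apply: XT_congr; [apply: orepD_congr.. | apply: e1; apply/negP
                      | apply: e3; apply/negP].
Qed.

Lemma kappa_id (i : 'Z_m) : i \in D -> kappa i = 0%N.
Proof.
move=> iD; have [iF|iF] := boolP (i \in F); first by rewrite /Defs.kappa iF.
by rewrite -(mul1r i) -(expr0 r%:R) kappa_rX // mod0n.
Qed.

Lemma orep_D (i : 'Z_m) : i \in D -> orep i = i.
Proof. by move=> iD; rewrite -[in LHS](mul1r i) -(expr0 r%:R) orep_rX. Qed.

Lemma tgt_rX (i j : 'Z_m) (p a k w : nat) : r%:R ^+ a * j = i - r%:R ^+ p ->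
  w = ((k + p) %% s)%N -> r%:R ^+ k * i - r%:R ^+ w = r%:R ^+ (k + a) * j.
Proof.
move=> jE ->; rewrite (rXmod m_gt0 rs1 r_neq1) exprD [in RHS]exprD -mulrA jE.
by rewrite mulrBr.
Qed.

(** Translation by r^k turns the type p into k + p, and [PhiX] subtracts k again. If i is not fixed,
    k is the [kappa] of the source. If i is fixed, k is invisible there, but it is the [kappa] of
    the target since a = 0. *)
Lemma PhiX_rX (i j : 'Z_m) (p a k w : 'I_s) : i \in D -> j \in D ->
  (i \in F -> a = 0%N :> nat) -> r%:R ^+ a * j = i - r%:R ^+ p ->
  w = ((k + p) %% s)%N :> nat -> PhiX (r%:R ^+ k * i) w = PhiX i p.
Proof.
move=> iD jD iF_a jE wE; apply: PhiX_congr;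
  rewrite ?(tgt_rX _ _ _ _ _ _ jE wE) ?(=^~ jE) ?orep_rX ?(orep_D i) //.
- move=> iF; rewrite kappa_rX // (kappa_id i) // modn_small //.
  by rewrite !(ord_subK _ _ p p) // add0n modn_small.
- move=> iF; rewrite (iF_a iF) addn0.
  (* No arrow joins two fixed points, so [kappa_rX] applies to the target. *)
  have jF : j \notin F.
    apply/negP => jF.
    apply: (Phi_ff s_gt0 m_gt0 rs1 r_neq1 D_reps (i := i) (q := p)).
      by rewrite orep_D.
    by rewrite -jE orep_rX.
  rewrite !kappa_rX // mod0n (modn_small (ltn_ord k)).
  by rewrite !(ord_subK _ _ p p) // add0n modn_small.
- move=> iF jF; rewrite !kappa_rX // (kappa_id i) // (modn_small (ltn_ord k)).
  have ka : ((k + a) %% s = Ordinal (ltn_pmod (k + a) s_gt0) :> nat)%N by [].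
  rewrite ka (ord_subK _ _ a a) //=; apply: val_inj.
  by rewrite /= subn0 modnDr !modn_mod modn_small.
Qed.

End Orbits.

(** * The grading on Q_G' and the lifting of paths to Q_A' *)

Section Lifting.

Context {C : fieldType} {m r s t : nat} {eps epss : C}.
Hypotheses (m_gt0 : (0 < m)%N) (r_neq1 : (r <> 1 %[mod m])%N).
Hypotheses (s_gt0 : (0 < s)%N) (rs1 : (r ^ s = 1 %[mod m])%N).
Hypothesis s_prime : prime s.
Hypothesis eps_prim : m.-primitive_root eps.
Hypothesis epss_prim : s.-primitive_root epss.
Context {D : {set 'Z_m}}.
Hypothesis D_fix : FixPts m r \subset D.
Hypothesis D_reps : orbit_reps r D.
Hypothesis D_cc : forall i, i \in D -> i + cc m r s \in D.
Context {eta : 'Z_m -> C}.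
Hypothesis eta_neq0 : forall i, i \in FixPts m r -> eta i != 0.
Context {tau : vertG r s D -> vertG r s D}.
Context {theta : forall S, 'M[C]_(dimG (tau S), dimG S)}.
Hypothesis theta_hom : forall S, is_hom r t eps
     (rhoG t eps epss eta S) (detinv_tensor (rhoG t eps epss eta (tau S)))
     (theta S).
Context {gA : grading (QA' m r s)}.
Hypothesis gA_Phi : gradable (Phi' D_cc s_gt0 m_gt0 rs1 r_neq1 D_reps) gA.

(* the element i of Z/m such that [alpha] acts by eps^i on the given basis
   vector of V *)
Definition wt (V : vertG r s D) : 'I_(dimG V) -> 'Z_m :=
  match V return 'I_(dimG V) -> 'Z_m with
  | inl i => fun k => r%:R ^+ k * val i
  | inr (i, _) => fun _ => val i
  end.

Definition vrep (V : vertG r s D) : 'Z_m :=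
  match V with inl i => val i | inr (i, _) => val i end.

(** The arrow of Q_A' chosen here leaves the representative in D, where [kappa] vanishes and the
    type is p itself; by gradability all arrows with the same image have its degree. *)
Definition gG : grading (QG' tau) := fun b =>
  match b with
  | XG i _ p _ _ => gA (XA (val i) p)
  | XGin i _ _ p _ => gA (XA (val i) p)
  | XGout i _ _ p _ => gA (XA (val i) p)
  | YG V => gA (YA s (vrep V))
  end.

Lemma vrep_D V : vrep V \in D.
Proof.
case: V => [i|[i l]] /=; first by have := valP i; rewrite inE => /andP[].
exact: (fintype.subsetP D_fix) (valP i).
Qed.

(** All weights of V lie in one orbit, so the lifts of an added arrow have the same image under Phi'
    at every weight. *)
Lemma orep_wt V k : orep r D (wt V k) = vrep V.
Proof.
have := vrep_D V; case: V k => [i|[i l]] k /= iD.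
  exact: (orep_rX m_gt0 r_neq1 s_gt0 rs1 D_reps).
exact: (orep_D m_gt0 r_neq1 s_gt0 rs1 D_reps).
Qed.

(** At a fixed point i, [alpha] acts on all of T_i as the scalar [eps ^+ i], hence also on each
    summand. *)
Lemma rhoG_alpha V k l :
  rhoG t eps epss eta V (alpha r s eps) k l = eps ^+ wt V k *+ (k == l).
Proof.
case: V k l => [i|[i q]] k l /=.
  exact: (indT_alpha t m_gt0 r_neq1 s_gt0 rs1 eps_prim).
have -> : indT r t eps (val i) (alpha r s eps) = (eps ^+ (val i : 'Z_m))%:M.
  apply/matrixP => x y; rewrite (indT_alpha t m_gt0 r_neq1 s_gt0 rs1 eps_prim).
  by rewrite (FixX _ (valP i)) mxE.
rewrite mul_mx_scalar -scalemxAl proj_incl_w // ?eta_neq0 ?(valP i) //.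
by rewrite !mxE mulr_natr.
Qed.

(** Equivariance at [alpha], read in entry (v, k): the nonzero entry cancels and leaves an equality
    of powers of [eps], to which det_V^-1 contributes the shift by [cc]. *)
Lemma theta_wt V v k : theta V v k != 0 -> wt _ v = wt _ k + cc m r s.
Proof.
move=> nz; have := theta_hom V _ (@G_alpha C r s t eps).
move/matrixP => /(_ v k); rewrite !mxE (bigD1 k) //= big1 ?addr0; last first.
  by move=> l lk; rewrite rhoG_alpha (negPf lk) mulr0n mulr0.
rewrite (bigD1 v) //= big1 ?addr0; last first.
  by move=> l lv; rewrite !mxE rhoG_alpha eq_sym (negPf lv) mulr0n mulr0 mul0r.
rewrite !mxE !rhoG_alpha !eqxx !mulr1n mulrC => /(mulIf nz).
rewrite (det_alpha m_gt0 r_neq1 eps_prim) => E.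
apply: (chi_inj m_gt0 r_neq1 eps_prim); rewrite (chiD m_gt0 r_neq1 eps_prim) E.
rewrite mulrAC mulVf ?mul1r // expf_neq0 //.
exact: (eps_neq0 m_gt0 eps_prim).
Qed.

Lemma arrG_lift (b : arr (QG' tau)) w v k :
    arrG_map t eps epss eta theta b w v k != 0 ->
  exists b' : arrA m s,
    [/\ srcA b' = wt _ k, tgtA r b' = wt _ v, typeA b' = w & gA b' = gG b].
Proof.
(* Every basis vector of W but the last is some basis vector x of V, and x is the type of the lifted
   arrow. *)
have ordw (x : 'I_s) : unlift ord_max w = Some x -> widen_ord (leqnSn s) x = w.
  case: unliftP => // y -> [<-]; apply: val_inj => /=.
  by rewrite /bump leqNgt ltn_ord.
(* Target and degree of the lift starting at weight r^x i, for all three kinds of arrows that come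
   from V. *)
have gX (i j : 'Z_m) (p a x y : 'I_s) : i \in D -> j \in D ->
    (i \in FixPts m r -> a = 0%N :> nat) ->
    r%:R ^+ a * j = i - r%:R ^+ p -> y = ((x + p) %% s)%N :> nat ->
    r%:R ^+ x * i - r%:R ^+ y = r%:R ^+ (x + a) * j /\
    gA (XA (r%:R ^+ x * i) y) = gA (XA i p).
  move=> iD jD iF_a jE yE; split.
    exact: (tgt_rX m_gt0 r_neq1 rs1 _ _ _ _ _ _ jE yE).
  apply: gA_Phi _ _ _ _ erefl.
  exact: (PhiX_rX m_gt0 r_neq1 s_gt0 rs1 s_prime D_reps _ _ _ _ _ _
    iD jD iF_a jE yE).
have supp := Gmap_supp t m_gt0 r_neq1 s_gt0 rs1 eps_prim.
have rmod := rXmod m_gt0 rs1 r_neq1.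
have z0 (j : 'Z_m) : r%:R ^+ Ordinal s_gt0 * j = j by rewrite mul1r.
case: b v k => [i j p a e|i j l p e|i l j p e|V] v k /=.
- have [iD iF] : val i \in D /\ val i \notin FixPts m r.
    by have := valP i; rewrite inE => /andP[].
  have jD := vrep_D (inl j).
  case E: (unlift ord_max w) => [x|]; last by rewrite mxE eqxx.
  case/supp=> xE vE.
  have [|jE gE] := gX _ _ _ _ k x iD jD _ (eqP e) xE; first by rewrite (negPf iF).
  exists (XA (r%:R ^+ k * val i) x); split => //=; last exact: ordw.
  by rewrite jE vE rmod.
- have iD := vrep_D (inl i); have jD := vrep_D (inr (j, l)).
  case E: (unlift ord_max w) => [x|]; last by rewrite mxE eqxx.
  case/mulmx_neq0 => y _ /supp[xE _].
  have [||jE gE] := gX _ _ _ (Ordinal s_gt0) k x iD jD _ _ xE => //.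
    by rewrite z0 /= (eqP e).
  exists (XA (r%:R ^+ k * val i) x); split => //=; last exact: ordw.
  by rewrite jE (FixX _ (valP j)).
- have iD := vrep_D (inr (i, l)); have jD := vrep_D (inl j).
  case E: (unlift ord_max w) => [x|]; last by rewrite mxE eqxx.
  case/mulmx_neq0 => y /supp[xE vE] _.
  have [||] := gX _ _ _ (Ordinal s_gt0) y x iD jD _ _ xE => //.
    by rewrite z0 /= (eqP e).
  (* The inclusion of T_i^(l) passes through some basis vector y of T_i, whose weight is i for every
     y. *)
  rewrite (FixX _ (valP i)) => jE gE.
  exists (XA (val i) x); split => //=; last exact: ordw.
  by rewrite jE vE rmod.
- case: (w =P ord_max) => [wE|_]; last by rewrite mxE eqxx.
  move=> /theta_wt vE; exists (YA s (wt V k)); split => //.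
  apply: gA_Phi _ _ _ _ erefl; congr YT; apply: orepD_congr.
  by rewrite orep_wt (orep_D m_gt0 r_neq1 s_gt0 rs1 D_reps) ?vrep_D.
Qed.

(** Induction on the path: the intermediate index z of a nonzero product entry is the basis vector
    at which consecutive lifts meet. *)
Lemma path_lift x y n (p : @qpath (QG' tau) x y n) (u : n.-tuple 'I_s.+1) v k :
    Defs.path_map (arrG_map t eps epss eta theta) p u v k != 0 ->
  exists q : @qpath (QA' m r s) (wt x k) (wt y v) n,
    [seq typeA b | b <- arrows q] = u /\ deg gA q = deg gG p.
Proof.
elim: {x y n} p u v k => [x|b y n p IH] u v k /=.
  rewrite mxE; case: (v =P k) => [->|_]; last by rewrite eqxx.
  by exists (PNil _); split; [rewrite tuple0 | rewrite /deg !big_nil].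
case/mulmx_neq0 => z /IH[q [qE qdeg]] /arrG_lift[b' [sE tE wE gE]].
(* The ends of [b'] equal the weights only propositionally, so the type of q is rewritten before
   [PCons] can be formed. *)
move: q qE qdeg; rewrite -sE -tE => q qE qdeg.
exists (PCons (Q := QA' m r s) q); split.
  by have /= -> := congr1 val (tuple_eta u); rewrite qE wE.
by rewrite /deg /= !big_cons gE; congr (_ + _).
Qed.

End Lifting.

(** * Supports of the two superpotentials *)

Lemma antisym_neq0 {K : fieldType} N k l (f : N.-tuple 'I_N -> 'M[K]_(k, l)) :
  antisym f != 0 -> exists (u : 'S_N) i j, f [tuple u x | x < N] i j != 0.
Proof.
move=> nz; have [u fu] : exists u : 'S_N, f [tuple u x | x < N] != 0.
  apply/existsP; apply: contraNT nz => /existsPn f0.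
  by apply/eqP/big1 => u _; move/negPn/eqP: (f0 u) => ->; rewrite scaler0.
have [i /existsP[j ij]] : exists i, [exists j, f [tuple u x | x < N] i j != 0].
  apply/existsP; apply: contraNT fu => /existsPn f0.
  apply/eqP/matrixP => i j; rewrite mxE.
  by have /existsPn/(_ j)/negPn/eqP := f0 i.
by exists u, i, j.
Qed.

(** The word of types determines the permutation, so the sum reduces to the single sign of u. *)
Lemma omegaA_neq0 {K : fieldType} {m r s : nat} (x y : 'Z_m)
    (q : @qpath (QA' m r s) x y s.+1) (u : 'S_s.+1) :
  [seq typeA b | b <- arrows q] = [tuple u k | k < s.+1] ->
  omegaA K q != 0.
Proof.
move=> qE; rewrite /omegaA (bigD1 u) /=; last by rewrite qE.
rewrite big1 ?addr0 ?signr_eq0 // => v /andP[/eqP vE /eqP vu].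
case: vu; apply/permP => k.
have /eq_in_map : [seq v k | k <- enum 'I_s.+1] = [seq u k | k <- enum 'I_s.+1].
  by rewrite -vE qE.
by apply; rewrite mem_enum.
Qed.

(** A zero composite would force z = 0, as its entry (0, 0) shows; this entry exists because all
    dimensions are positive. The default of [xget] is 0 as well. *)
Lemma omegaG_neq0 {K : fieldType} {m r s t : nat} {eps epss : K}
    {eta : 'Z_m -> K} {D : {set 'Z_m}} {tau : vertG r s D -> vertG r s D}
    {theta : forall V, 'M[K]_(dimG (tau V), dimG V)} x y
    (p : @qpath (QG' tau) x y s.+1) : (0 < s)%N ->
  omegaG t eps epss eta theta p != 0 ->
  antisym (Defs.path_map (arrG_map t eps epss eta theta) p) != 0.
Proof.
move=> s_gt0; rewrite mulf_eq0 negb_or => /andP[nz _]; move: nz.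
rewrite /path_scalar; case: ifP => _; last by rewrite eqxx.
case: xgetP => [z _ /= zE|_]; last by rewrite eqxx.
have dim_gt0 V : (0 < dimG (V : vertG r s D))%N by case: V => [i|[i l]].
apply: contraNN => /eqP; rewrite zE => /matrixP.
move=> /(_ (Ordinal (dim_gt0 y)) (Ordinal (dim_gt0 x))).
by rewrite !mxE /= mulr1n => ->.
Qed.

Theorem proposition6p24 (R : realType) (m r s t : nat)
  (m_gt0 : (0 < m)%N) (r_gt0 : (0 < r)%N)
  (s_gt0 : (0 < s)%N) (t_gt0 : (0 < t)%N)
  (co_mr : coprime m r)
  (rs1 : (r ^ s = 1 %[mod m])%N)
  (rt0 : (m %| (r - 1) * t)%N)
  (s_prime : prime s)
  (r_neq1 : (r <> 1 %[mod m])%N)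
  (eps epss : R[i])
  (eps_prim : m.-primitive_root eps)
  (epss_prim : s.-primitive_root epss)
  (D : {set 'Z_m})
  (D_fix : FixPts m r \subset D)
  (D_reps : orbit_reps r D)
  (D_cc : forall i, i \in D -> i + cc m r s \in D)
  (eta : 'Z_m -> R[i])
  (eta_root : forall i, i \in FixPts m r -> eta i ^+ s = eps ^+ (t * i))
  (tau : vertG r s D -> vertG r s D)
  (tauP : forall S, rep_iso r t eps
     (det_tensor (rhoG t eps epss eta S)) (rhoG t eps epss eta (tau S)))
  (theta : forall S, 'M[R[i]]_(dimG (tau S), dimG S))
  (theta_hom : forall S, is_hom r t eps
     (rhoG t eps epss eta S) (detinv_tensor (rhoG t eps epss eta (tau S)))
     (theta S))
  (theta_neq0 : forall S, theta S != 0)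
  (gA : grading (QA' m r s)) (a : int)
  (gA_hom : homogeneous gA (@omegaA m r s R[i]) a)
  (gA_Phi : gradable (Phi' D_cc s_gt0 m_gt0 rs1 r_neq1 D_reps) gA) :
  exists gG : grading (QG' tau),
    homogeneous gG (@omegaG _ _ _ _ t eps epss eta _ _ theta) a.
Proof.
(* An s-th root of a power of [eps] is nonzero, which makes [wmx] invertible at fixed points. *)
have eta_neq0 i : i \in FixPts m r -> eta i != 0.
  move/eta_root => e; apply: contraTneq (eps_neq0 m_gt0 eps_prim) => eta0.
  have := expf_neq0 (t * i) (eps_neq0 m_gt0 eps_prim).
  by rewrite -e eta0 expr0n gtn_eqF // eqxx.
exists (gG (gA := gA)) => x y p /(omegaG_neq0 _ _ _ s_gt0) /antisym_neq0[u [v [k]]].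
case/(path_lift m_gt0 r_neq1 s_gt0 rs1 s_prime eps_prim epss_prim D_fix D_reps
  D_cc eta_neq0 theta_hom gA_Phi) => q [qE <-].
exact: gA_hom (omegaA_neq0 _ _ _ _ qE).
Qed.
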